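(* Let $(Y,d)$ be a complete and separable metric space. Then the metric space $(M(Y),H)$ is the completion of the metric space $(M_{\mathrm{loc}}(Y),H)$.
   Context: $M_{\mathrm{loc}}(Y)$ is the collection of Borel probability measures on $Y$ that have bounded support, where the support of a Borel measure $\nu$ is $\mathrm{supp}(\nu)=Y\setminus\bigcup\{A\subseteq Y: A \text{ open},\ \nu(A)=0\}$. $\mathrm{Lip}(Y)$ is the collection of all real-valued Lipschitz functions on $Y$, and $M(Y)$ is the collection of Borel probability measures $\nu$ on $Y$ such that $\int_Y |f|\,d\nu<\infty$ for all $f\in\mathrm{Lip}(Y)$. One has $M_{\mathrm{loc}}(Y)\subseteq M(Y)$. Let $\mathrm{Lip}_1(Y)=\{f:Y\to\mathbb{R} : |f(x)-f(y)|\le d(x,y)\text{ for all }x,y\in Y\}$. The Kantorovich metric $H$ on $M(Y)$ (and, by restriction, on $M_{\mathrm{loc}}(Y)$) is $$H(\mu,\nu)=\sup_{f\in\mathrm{Lip}_1(Y)}\left|\int_Y f\,d\mu-\int_Y f\,d\nu\right|.$$ That $(M(Y),H)$ is the completion of $(M_{\mathrm{loc}}(Y),H)$ means that $(M(Y),H)$ is a complete metric space and $M_{\mathrm{loc}}(Y)$ is dense in it. *)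

(* Defs.v *)
From HB Require Import structures.
From mathcomp Require Import all_boot all_order all_algebra.
From mathcomp Require Import all_classical all_reals all_analysis.

Set Implicit Arguments.
Unset Strict Implicit.
Unset Printing Implicit Defensive.
Import Order.TTheory GRing.Theory Num.Theory.

Local Open Scope classical_set_scope.
Local Open Scope ring_scope.

(* Pointed, as every completeType of the library is: since measurable types are
   pointed too, only the empty space, which carries no probability measure, is
   left out. *)
#[short(type="completeMetricType")]
HB.structure Definition CompleteMetric (R : numDomainType) :=
  {T of Metric R T & Complete T}.

Definition separable (T : topologicalType) : Prop :=
  exists2 S : set T, countable S & dense S.

(* The axiom of completeType, for uniform spaces that need not be pointed. *)
Definition complete_space (T : uniformType) : Prop :=
  forall F : set_system T, ProperFilter F -> cauchy F -> exists l : T, F --> l.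

Definition metric_bounded {R : realType} {T : metricType R} (A : set T) : Prop :=
  exists M : R, forall x y, A x -> A y -> mdist x y <= M.

Record is_metric {R : realType} {T : Type} (d : T -> T -> R) : Prop := IsMetric {
  is_metric_xx : forall x, d x x = 0 ;
  is_metric_eq : forall x y, d x y = 0 -> x = y ;
  is_metric_sym : forall x y, d x y = d y x ;
  is_metric_triangle : forall y x z, d x z <= d x y + d y z }.

Definition metrized {R : realType} {T : choiceType} {d : T -> T -> R}
  (dP : is_metric d) : Type := T.

Section metrized_instance.
Context {R : realType} {T : choiceType} {d : T -> T -> R} (dP : is_metric d).

HB.instance Definition _ := Choice.on (metrized dP).
HB.instance Definition _ := @isMetric.Build R (metrized dP) d
  (is_metric_xx dP) (is_metric_eq dP) (is_metric_sym dP)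
  (is_metric_triangle dP).

End metrized_instance.

Section kantorovich.
Context {R : realType} (Y : completeMetricType R).

Definition borel : measurableType _ := g_sigma_algebraType (@open Y).

(* A probability of the library is a function on all subsets, whose values
   outside the sigma-algebra are unconstrained but count for equality. A Borel
   measure is represented by the extension that vanishes there; see
   borel_probability_exists_unique. *)
Definition borel_probability : set (probability borel R) :=
  [set mu | forall A : set borel, ~ measurable A -> mu A = 0%E].

Definition supp (mu : probability borel R) : set Y :=
  ~` \bigcup_(A in [set A : set Y | open A /\ mu A = 0%E]) A.

Definition Mloc : set (probability borel R) :=
  borel_probability `&` [set mu | metric_bounded (supp mu)].

Definition Lip : set (Y -> R) :=
  [set f | exists k : R, forall x y, `|f x - f y| <= k * mdist x y].

Definition Lip1 : set (Y -> R) :=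
  [set f | forall x y, `|f x - f y| <= mdist x y].

Definition M : set (probability borel R) :=
  borel_probability `&`
  [set mu | forall f, Lip f ->
    (\int[mu]_(y in [set: borel]) `|f y|%:E < +oo)%E].

(* Extended real, so that the supremum of an unbounded set is not a junk value. *)
Definition kantorovich (mu nu : probability borel R) : \bar R :=
  ereal_sup [set `|\int[mu]_(y in [set: borel]) (f y)%:E
                   - \int[nu]_(y in [set: borel]) (f y)%:E|%E | f in Lip1].

Definition kantorovich_dist (mu nu : M) : R :=
  fine (kantorovich (val mu) (val nu)).

End kantorovich.
Arguments Mloc {R} Y.
Arguments M {R} Y.
Arguments kantorovich_dist {R} Y.

Section borel_probability_representation.
Context {R : realType} {Y : completeMetricType R}.
Variable P : probability (borel Y) R.

Definition zero_extension (A : set (borel Y)) : \bar R :=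
  if pselect (measurable A) then P A else 0%E.

Let zero_extensionE A : measurable A -> zero_extension A = P A.
Proof. by rewrite /zero_extension; case: pselect. Qed.

Let zero_extension0 : zero_extension set0 = 0%E.
Proof. by rewrite zero_extensionE// measure0. Qed.

Let zero_extension_ge0 A : (0 <= zero_extension A)%E.
Proof.
by rewrite /zero_extension; case: pselect => mA; [exact: measure_ge0|].
Qed.

Let zero_extension_sigma_additive : semi_sigma_additive zero_extension.
Proof.
move=> F mF tF mUF; rewrite zero_extensionE//.
under eq_fun do under eq_bigr do rewrite zero_extensionE//.
exact: measure_semi_sigma_additive.
Qed.

HB.instance Definition _ := isMeasure.Build _ _ _ zero_extension
  zero_extension0 zero_extension_ge0 zero_extension_sigma_additive.

Let zero_extensionT : zero_extension setT = 1%E.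
Proof. by rewrite zero_extensionE// probability_setT. Qed.

HB.instance Definition _ :=
  Measure_isProbability.Build _ _ _ zero_extension zero_extensionT.

Let probability_ext (mu nu : probability (borel Y) R) :
  mu = nu :> (set (borel Y) -> \bar R) -> mu = nu.
Proof.
case: mu => m [[m0 m1] [m2] [m3] [m4] [m5] [m6] [m7]].
case: nu => n [[n0 n1] [n2] [n3] [n4] [n5] [n6] [n7]] /= mn; subst n.
by rewrite (Prop_irrelevance n0 m0) (Prop_irrelevance n1 m1)
  (Prop_irrelevance n2 m2) (Prop_irrelevance n3 m3) (Prop_irrelevance n4 m4)
  (Prop_irrelevance n5 m5) (Prop_irrelevance n6 m6) (Prop_irrelevance n7 m7).
Qed.

Lemma borel_probability_exists_unique :
  exists! mu : probability (borel Y) R,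
    borel_probability mu /\ forall A, measurable A -> mu A = P A.
Proof.
exists (zero_extension : probability (borel Y) R); split.
  split=> [A nmA|A]; last exact: zero_extensionE.
  by rewrite /= /zero_extension; case: pselect.
move=> nu [nu0 nuP].
apply: probability_ext; apply/funext => A; rewrite /= /zero_extension.
case: pselect => mA; first by rewrite nuP.
by rewrite nu0.
Qed.

End borel_probability_representation.

(* Main.v *)
Require Import Defs.
From HB Require Import structures.
From mathcomp Require Import all_boot all_order all_algebra.
From mathcomp Require Import all_classical all_reals all_analysis.
From mathcomp Require Import measurable_realfun lra.

(** The integrals of a 1-Lipschitz function against two measures of M(Y)
differ by at most the sum of the two mean distances to a base point, so the
Kantorovich distance is finite. It separates measures because every open set
is [{g > 0}] for some 1-Lipschitz [g >= 0]: then [min(1, n g)] increases to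
the indicator of that set, and Lipschitz integrals determine the measure of
every open set ([mint_separates]).

Density ([Mloc_approx]). Push a measure forward along the map that fixes the
closed ball of radius [2 n] around the base point and collapses the rest to
that point. The image has bounded support, and a point at distance [t] from the
base point moves by at most [2 max(0, t - n)], whose integral tends to 0 with
[n]. That a measure with bounded support belongs to M(Y) uses separability,
which makes the complement of the support a null set ([supp_null]).

Completeness ([cauchy_filter_cvg]). Along a Cauchy filter of measures the
integrals of each Lipschitz function [f] converge to a number [L f], uniformly
for [f] in Lip1. The functional [L] is linear, positive and normalized.
Moreover, if 1-Lipschitz functions [h n] decrease to 0 pointwise then [L (h n)]
tends to 0, since by uniformity [L] can be compared on all of them with the
integral against a single measure of M(Y). The record [lip_mean] collects these
properties. A functional of this kind is the integral against a measure of M(Y)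
([M_representation]), and the filter converges to that measure by uniformity.

The representation theorem is proved in the manner of Daniell and Riesz. The
outer measure of a set is the infimum of the bounds of [L] along increasing
sequences of nonnegative Lipschitz functions that reach 1 at each point of the
set. Linearity, positivity and normalization make it an outer measure for which
the sets [{g > 0}], hence all Borel sets, are Caratheodory measurable. The
whole space must then be shown to have measure 1, and here completeness and
separability enter ([full_cover_ge1]): the distances to the first [k] points of
a dense sequence are 1-Lipschitz and decrease to 0, so [L] makes them small,
which confines the mass to totally bounded sets, where a compactness argument
applies. Cutting a function into thin horizontal layers gives [\int f <= L f]
for [f >= 0] ([integral_le_mean]); since the total mass is 1, the same bound
for [c - f] gives the converse when [f <= c], and truncation removes the bound,
the tails [max(0, f - n)] being controlled by the continuity property of [L]
([mintE_mean]). *)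

Set Implicit Arguments.
Unset Strict Implicit.
Unset Printing Implicit Defensive.
Import Order.TTheory GRing.Theory Num.Theory.
Import numFieldNormedType.Exports.
Local Open Scope classical_set_scope.
Local Open Scope ring_scope.

(** * Lipschitz functions *)

Lemma exists_natSinv_lt {R : realType} (e : R) : 0 < e ->
  exists n, n.+1%:R^-1 < e.
Proof.
move=> e0; exists (Num.truncn e^-1); rewrite -[ltRHS]invrK.
by rewrite ltf_pV2 ?posrE ?invr_gt0// truncnS_gt.
Qed.

Section klip.
Context {R : realType} {Y : metricType R}.
Implicit Types (f g : Y -> R) (k l c : R).

(** The one-sided inequality, read with the two points exchanged, is the usual
Lipschitz condition ([klip_normP]); without an absolute value it passes
through minima and maxima with the same constant. *)
Definition klip k f := forall x y, f x <= f y + k * mdist x y.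

Lemma klip_le k l f : k <= l -> klip k f -> klip l f.
Proof.
move=> kl fk x y; apply: le_trans (fk x y) _.
by rewrite lerD2l ler_wpM2r// mdist_ge0.
Qed.

Lemma klip_cst k c : 0 <= k -> klip k (fun=> c).
Proof. by move=> k0 x y; rewrite lerDl mulr_ge0// mdist_ge0. Qed.

Lemma klipD k l f g : klip k f -> klip l g -> klip (k + l) (fun x => f x + g x).
Proof. by move=> fk gl x y; have := fk x y; have := gl x y; lra. Qed.

Lemma klipN k f : klip k f -> klip k (fun x => - f x).
Proof. by move=> fk x y; have := fk y x; rewrite metric_sym; lra. Qed.

Lemma klipZ k c f : 0 <= c -> klip k f -> klip (c * k) (fun x => c * f x).
Proof.
by move=> c0 fk x y; rewrite -mulrA -mulrDr ler_wpM2l.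
Qed.

(** The constant [k + 1] rather than [k] allows [k = 0]. *)
Lemma klip_rescale k f : 0 <= k -> klip k f ->
  klip 1 (fun x => (k + 1)^-1 * f x).
Proof.
move=> k0 fk; have k1 : 0 < k + 1 by lra.
apply: (@klip_le ((k + 1)^-1 * k)); first by rewrite mulrC ler_pdivrMr//; lra.
by apply: klipZ => //; rewrite invr_ge0 ltW.
Qed.

Lemma klip_min k f g : klip k f -> klip k g ->
  klip k (fun x => Num.min (f x) (g x)).
Proof.
move=> fk gk x y; rewrite -lerBlDr le_min !lerBlDr !ge_min.
by rewrite fk gk orbT.
Qed.

Lemma klip_max k f g : klip k f -> klip k g ->
  klip k (fun x => Num.max (f x) (g x)).
Proof.
move=> fk gk x y; rewrite ge_max -!lerBlDr !le_max !lerBlDr.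
by rewrite fk gk orbT.
Qed.

Lemma klip_dist a : klip 1 (mdist a).
Proof. by move=> x y; rewrite mul1r [mdist x y]metric_sym metric_triangle. Qed.

Lemma klip_normP k f :
  klip k f <-> forall x y, `|f x - f y| <= k * mdist x y.
Proof.
split=> fk x y.
  by rewrite ler_norml; have := fk x y; have := fk y x; rewrite metric_sym; lra.
by have := fk x y; rewrite ler_norml; lra.
Qed.

Lemma klip_gt_open k f a : 0 <= k -> klip k f -> open [set y | a < f y].
Proof.
move=> k0 fk; rewrite openE => y /= afy.
apply/nbhs_ballP; exists ((f y - a) / (k + 1)) => /=.
  by rewrite divr_gt0 ?subr_gt0// (ltr_wpDl k0).
move=> z; rewrite ballEmdist/= ltr_pdivlMr ?(ltr_wpDl k0)// => yz.
by have := fk y z; have := mdist_ge0 y z; nra.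
Qed.

(** The function is the distance to the complement of [U]. *)
Lemma open_klip (U : set Y) : open U ->
  exists g, [/\ klip 1 g, forall x, 0 <= g x & U = [set x | 0 < g x]].
Proof.
move=> oU; have [UT|/set0P[z0 Uz0]] := eqVneq (~` U) set0.
  (* there is no distance to an empty complement: any positive constant does *)
  exists (fun=> 1); split => //; first exact: klip_cst.
  by rewrite -[U]setCK UT setC0; apply/seteqP; split => x _ //=; exact: ltr01.
pose D x := [set mdist x z | z in ~` U].
have D0 x : D x !=set0 by exists (mdist x z0); exists z0.
have Dlb x : lbound (D x) 0 by move=> _ [z _ <-]; exact: mdist_ge0.
have Dinf x z : ~ U z -> inf (D x) <= mdist x z.
  by move=> Uz; apply: ge_inf; [exists 0|exists z].
exists (fun x => inf (D x)); split.
- move=> x y; rewrite mul1r -lerBlDr; apply: lb_le_inf => // _ [z Uz <-].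
  by have := Dinf x _ Uz; have := metric_triangle x y z; lra.
- by move=> x; exact: lb_le_inf.
- apply/seteqP; split=> x /=.
    move: oU; rewrite openE => /[apply] /nbhs_ballP[e /= e0 xeU].
    apply: lt_le_trans e0 _; apply: lb_le_inf => // _ [z Uz <-].
    rewrite leNgt; apply/negP => xze; apply: Uz; apply: xeU.
    by rewrite ballEmdist.
  move=> gx; apply: contrapT => Ux.
  by have := Dinf x _ Ux; rewrite mdistxx leNgt gx.
Qed.

End klip.

Section Lipschitz.
Context {R : realType} {Y : completeMetricType R}.
Implicit Types (f g : Y -> R) (k c : R).

Lemma LipP f : Lip f <-> exists2 k, 0 <= k & klip k f.
Proof.
split=> [[k fk]|[k _ /klip_normP fk]]; last by exists k.
exists `|k|; first exact: normr_ge0.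
apply: (@klip_le _ _ k); first exact: ler_norm.
exact/klip_normP.
Qed.

Lemma Lip1P f : Lip1 f <-> klip 1 f.
Proof.
rewrite klip_normP; split=> fk x y; first by rewrite mul1r; exact: fk.
by have := fk x y; rewrite mul1r.
Qed.

Lemma klip_Lip k f : 0 <= k -> klip k f -> Lip f.
Proof. by move=> k0 fk; apply/LipP; exists k. Qed.

Lemma Lip1_Lip f : Lip1 f -> Lip f.
Proof. by move/Lip1P => f1; apply: klip_Lip f1. Qed.

Lemma Lip_cst c : Lip (fun _ : Y => c).
Proof. by apply/LipP; exists 0 => //; exact: klip_cst. Qed.

Lemma LipD f g : Lip f -> Lip g -> Lip (fun x => f x + g x).
Proof.
move=> /LipP[k k0 fk] /LipP[l l0 gl].
by apply/LipP; exists (k + l); [rewrite addr_ge0|exact: klipD].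
Qed.

Lemma LipN f : Lip f -> Lip (fun x => - f x).
Proof. by move=> /LipP[k k0 fk]; apply/LipP; exists k => //; exact: klipN. Qed.

Lemma LipB f g : Lip f -> Lip g -> Lip (fun x => f x - g x).
Proof. by move=> fL gL; exact: LipD (LipN _). Qed.

Lemma LipZ c f : Lip f -> Lip (fun x => c * f x).
Proof.
move=> /LipP[k k0 fk]; have [c0|c0] := leP 0 c.
  by apply: (@klip_Lip (c * k)); [rewrite mulr_ge0|exact: klipZ].
apply: (@klip_Lip (- c * k)); first by rewrite mulr_ge0// oppr_ge0 ltW.
rewrite (_ : (fun x => _) = fun x => - (- c * f x)).
  by apply: klipN; apply: klipZ => //; rewrite oppr_ge0 ltW.
by apply/funext => x; rewrite mulNr opprK.
Qed.

Lemma Lip_min f g : Lip f -> Lip g -> Lip (fun x => Num.min (f x) (g x)).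
Proof.
move=> /LipP[k k0 fk] /LipP[l l0 gl]; apply/LipP.
exists (k + l); first by rewrite addr_ge0.
apply: klip_min; first by apply: klip_le fk; rewrite lerDl.
by apply: klip_le gl; rewrite lerDr.
Qed.

Lemma Lip_minc f c : Lip f -> Lip (fun x => Num.min (f x) c).
Proof. by move=> fL; apply: Lip_min => //; exact: Lip_cst. Qed.

Lemma Lip_max f g : Lip f -> Lip g -> Lip (fun x => Num.max (f x) (g x)).
Proof.
move=> /LipP[k k0 fk] /LipP[l l0 gl]; apply/LipP.
exists (k + l); first by rewrite addr_ge0.
apply: klip_max; first by apply: klip_le fk; rewrite lerDl.
by apply: klip_le gl; rewrite lerDr.
Qed.

Lemma Lip_sum n (f : nat -> Y -> R) : (forall i, Lip (f i)) ->
  Lip (fun x => \sum_(i < n) f i x).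
Proof.
move=> fL; elim: n => [|n ih].
  by under eq_fun do rewrite big_ord0; exact: Lip_cst.
by under eq_fun do rewrite big_ord_recr/=; exact: LipD.
Qed.

Lemma Lip_dist a : Lip (mdist a : Y -> R).
Proof. exact: klip_Lip (klip_dist a). Qed.

Lemma open_borel (U : set Y) : open U -> measurable (U : set (borel Y)).
Proof. exact: sub_sigma_algebra. Qed.

Lemma Lip_measurable f : Lip f -> measurable_fun [set: borel Y] f.
Proof.
move=> /LipP[k k0 fk]; apply: (measurability _ (RGenOInfty.measurableE R)).
move=> _ [_ [a ->] <-]; rewrite setTI; apply: open_borel.
rewrite (_ : _ @^-1` _ = [set y | a < f y]); first exact: klip_gt_open fk.
by apply/seteqP; split=> x /=; rewrite in_itv/= andbT.
Qed.

Lemma Lip_emeasurable f : Lip f ->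
  measurable_fun [set: borel Y] (fun x => (f x)%:E).
Proof. by move=> fL; apply/measurable_EFinP; exact: Lip_measurable. Qed.

End Lipschitz.

(** * Positive functionals on Lipschitz functions and their outer measure *)

(** Applied to nondecreasing sequences: from the index [m] on, they gain at
most [e]. *)
Lemma bounded_almost_max {R : realType} (u : nat -> R) (c e : R) : 0 < e ->
  (forall n, u n <= c) -> exists m, forall n, u n <= u m + e.
Proof.
move=> e0 uc; have ub : has_ubound (range u) by exists c => _ [n _ <-].
have [|_ [m _ <-] um] := sup_adherent e0 (E := range u).
  by split => //; exists (u 0%N); exists 0%N.
exists m => n; have : u n <= sup (range u) by apply: ub_le_sup => //; exists n.
by lra.
Qed.

Section mean.
Context {R : realType} {Y : completeMetricType R}.
Implicit Types (f g : Y -> R) (c : R) (A : set Y).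

(** The last axiom is a continuity property. It concerns sequences with a common
Lipschitz constant because a limit of integrals that is uniform on Lip1
inherits it for such sequences. *)
Record lip_mean (L : (Y -> R) -> R) : Prop := LipMean {
  mean1 : L (fun=> 1) = 1 ;
  meanD : forall f g, Lip f -> Lip g -> L (fun x => f x + g x) = L f + L g ;
  meanZ : forall c f, Lip f -> L (fun x => c * f x) = c * L f ;
  mean_ge0 : forall f, Lip f -> (forall x, 0 <= f x) -> 0 <= L f ;
  mean_cvg0 : forall h : nat -> Y -> R, (forall n, Lip1 (h n)) ->
    (forall n x, 0 <= h n x) -> (forall n x, h n.+1 x <= h n x) ->
    (forall x e, 0 < e -> exists n, h n x <= e) ->
    forall e, 0 < e -> exists n, L (h n) <= e }.

Variables (L : (Y -> R) -> R) (Lm : lip_mean L).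

Lemma mean_cst c : L (fun=> c) = c.
Proof.
rewrite -[RHS]mulr1 -(mean1 Lm) -(meanZ Lm); last exact: Lip_cst.
by congr L; apply/funext => x; rewrite mulr1.
Qed.

Lemma meanB f g : Lip f -> Lip g -> L (fun x => f x - g x) = L f - L g.
Proof.
move=> fL gL; rewrite -[- L g]mulN1r -(meanZ Lm)//.
rewrite -(meanD Lm)//; last exact: LipZ.
by congr L; apply/funext => x; rewrite mulN1r.
Qed.

Lemma mean_le f g : Lip f -> Lip g -> (forall x, f x <= g x) -> L f <= L g.
Proof.
move=> fL gL fg; rewrite -subr_ge0 -meanB//.
by apply: (mean_ge0 Lm) => [|x]; [exact: LipB|rewrite subr_ge0].
Qed.

Lemma mean_sum n (f : nat -> Y -> R) : (forall i, Lip (f i)) ->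
  L (fun x => \sum_(i < n) f i x) = \sum_(i < n) L (f i).
Proof.
move=> fL; elim: n => [|n ih].
  by under eq_fun do rewrite big_ord0; rewrite mean_cst big_ord0.
under eq_fun do rewrite big_ord_recr/=.
by rewrite (meanD Lm)// ?ih ?big_ord_recr//; exact: Lip_sum.
Qed.

(** The sequence [f] witnesses that [A] has outer measure at most [c]. A whole
sequence is needed because the indicator of an open set is only an increasing
limit of Lipschitz functions. *)
Record lip_cover A c (f : nat -> Y -> R) : Prop := LipCover {
  cover_Lip : forall n, Lip (f n) ;
  cover_ge0 : forall n x, 0 <= f n x ;
  cover_ndS : forall n x, f n x <= f n.+1 x ;
  cover_ge1 : forall x, A x -> exists n, 1 <= f n x ;
  cover_mean : forall n, L (f n) <= c }.

Lemma cover_nd A c (f : nat -> Y -> R) x m n : lip_cover A c f ->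
  (m <= n)%N -> f m x <= f n x.
Proof.
move=> cf; apply: (nondecreasing_seqP (f^~ x)).1 => k; exact: cover_ndS cf k x.
Qed.

Definition outer A : \bar R :=
  ereal_inf [set c%:E | c in [set c | exists u, lip_cover A c u]].

Lemma outer_le A c (f : nat -> Y -> R) : lip_cover A c f -> (outer A <= c%:E)%E.
Proof. by move=> cf; apply: ereal_inf_lbound; exists c => //; exists f. Qed.

Lemma outer_ge A e :
  (forall c (f : nat -> Y -> R), lip_cover A c f -> (e <= c%:E)%E) ->
  (e <= outer A)%E.
Proof.
by move=> h; apply: le_ereal_inf_tmp => _ [c [f cf] <-]; exact: h cf.
Qed.

Lemma cover_cst1 A : lip_cover A 1 (fun _ _ => 1).
Proof.
split => //; first by move=> n; exact: Lip_cst.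
- by move=> x _; exists 0%N.
- by move=> n; rewrite mean_cst.
Qed.

Lemma outer_le1 A : (outer A <= 1)%E.
Proof. exact: outer_le (cover_cst1 A). Qed.

Lemma outer_nonneg A : (0 <= outer A)%E.
Proof.
apply: outer_ge => c f cf; rewrite lee_fin; apply: le_trans (cover_mean cf 0).
apply: (mean_ge0 Lm); [exact: cover_Lip cf _|exact: cover_ge0 cf _].
Qed.

Lemma outer_fin A : outer A \is a fin_num.
Proof.
by rewrite ge0_fin_numE ?outer_nonneg// (le_lt_trans (outer_le1 A))// ltry.
Qed.

Lemma outer_approx A e : 0 < e -> exists c (f : nat -> Y -> R),
  lip_cover A c f /\ (c%:E <= outer A + e%:E)%E.
Proof.
move=> e0; have [_ [c [f cf] <-] ce] := lb_ereal_inf_adherent e0 (outer_fin A).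
by exists c, f; split => //; exact: ltW.
Qed.

Lemma outer_set0 : outer set0 = 0%E.
Proof.
apply/eqP; rewrite eq_le outer_nonneg andbT.
apply: (@outer_le _ _ (fun _ _ => 0)); split => //.
- by move=> n; exact: Lip_cst.
- by move=> n; rewrite mean_cst.
Qed.

Lemma outer_mono : {homo outer : A B / A `<=` B >-> (A <= B)%E}.
Proof.
move=> A B AB; apply: outer_ge => c f cf; apply: (@outer_le _ _ f).
by case: cf => *; split => // x /AB; eauto.
Qed.

(** Given near-optimal sequences [f i] for the sets [A i], the diagonal
partial sums [\sum_(i < n) f i n] form a single increasing sequence for the
union. *)
Lemma outer_sigma : sigma_subadditive outer.
Proof.
move=> A; apply/lee_addgt0Pr => e e0.
rewrite (le_trans _ (epsilon_trick _ _ _))//; last exact: ltW.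
  2: by move=> n; exact: outer_nonneg.
have /choice[c /choice[f cf]] n : exists c (f : nat -> Y -> R),
    lip_cover (A n) c f /\ (c%:E <= outer (A n) + (e / (2 ^ n.+1)%:R)%:E)%E.
  by apply: outer_approx; rewrite divr_gt0.
pose g n x := \sum_(i < n) f i n x.
have fL i n : Lip (f i n) by exact: cover_Lip (cf i).1 _.
have f0 i n x : 0 <= f i n x by exact: cover_ge0 (cf i).1 _ _.
have gge i n x : (i < n)%N -> f i n x <= g n x.
  by move=> lin; rewrite /g (bigD1 (Ordinal lin))//= lerDl sumr_ge0.
have term_ge0 i : (0 <= outer (A i) + (e / (2 ^ i.+1)%:R)%:E)%E.
  by rewrite adde_ge0 ?outer_nonneg// lee_fin divr_ge0// ltW.
set S := limn _; have S0 : (0 <= S)%E.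
  by apply: nneseries_ge0 => n _ _; exact: term_ge0.
have [Soo|Sfin] := eqVneq S +oo%E; first by rewrite Soo leey.
have SE : S = (fine S)%:E by rewrite fineK// ge0_fin_numE// ltey.
rewrite SE; apply: (@outer_le _ _ g); split.
- by move=> n; apply: (@Lip_sum R Y n (fun i => f i n)) => i; exact: fL.
- by move=> n x; exact: sumr_ge0.
- move=> n x; rewrite /g big_ord_recr/= ler_wpDr//.
  by apply: ler_sum => i _; exact: cover_ndS (cf i).1 _ _.
- move=> x [i _ Aix]; have [n fin] := cover_ge1 (cf i).1 Aix.
  exists (maxn n i.+1); apply: le_trans fin _.
  apply: le_trans (gge i _ x (leq_maxr _ _)).
  exact: cover_nd (cf i).1 (leq_maxl _ _).
- move=> n; rewrite (@mean_sum n (fun i => f i n))// -lee_fin -SE.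
  apply: (@le_trans _ _ (\sum_(0 <= i < n) (c i)%:E)%E).
    rewrite big_mkord sumEFin lee_fin; apply: ler_sum => i _.
    exact: cover_mean (cf i).1 _.
  apply: le_trans (nneseries_lim_ge n _) => [|i _ _]; last exact: term_ge0.
  by apply: lee_sum => i _; exact: (cf i).2.
Qed.

(** [ramp g m] vanishes where [g <= 1/m] and is 1 where [g >= 2/m]; it
increases with [m] to the indicator of [{g > 0}]. *)
Let ramp g m x : R := Num.min 1 (Num.max 0 (m%:R * g x - 1)).

Let ramp_Lip g m : Lip g -> Lip (ramp g m).
Proof.
move=> gL; apply: Lip_min; first exact: Lip_cst.
by apply: Lip_max; [exact: Lip_cst|apply: LipB; [exact: LipZ|exact: Lip_cst]].
Qed.

Let ramp_nd g m n x : 0 <= g x -> (m <= n)%N -> ramp g m x <= ramp g n x.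
Proof.
move=> g0 mn; rewrite /ramp le_min ge_min lexx/= ge_min; apply/orP; right.
by rewrite ge_max !le_max lexx/= lerB// ?ler_wpM2r ?ler_nat ?orbT.
Qed.

Let ramp_le1 g m x : ramp g m x <= 1.
Proof. by rewrite /ramp ge_min lexx. Qed.

(** A sequence [f] for [X] has to be split between [{g > 0}] and its
complement. Cutting it at the height of [phi = min(1, m g)] does so exactly,
[f = p + r]: the excess [r] is all of [f] where [g = 0], while [p] still
reaches 1 where [m g >= 1]. The remaining shell [{0 < g < 1/m}] is covered by
[q], the differences of [ramp g (m + n)] and [ramp g m], which cost at most
[e] once [m] is large, as the [L (ramp g n)] increase and are bounded by 1. *)
Lemma outer_caratheodory_gt0 g : Lip g -> (forall x, 0 <= g x) ->
  forall X, (outer (X `&` [set x | 0 < g x]%R) +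
             outer (X `&` ~` [set x | 0 < g x]%R) <= outer X)%E.
Proof.
move=> gL g0 X; apply: outer_ge => c f cf; apply/lee_addgt0Pr => e e0.
have [m rm] : exists m, forall n, L (ramp g n) <= L (ramp g m) + e.
  apply: (@bounded_almost_max _ _ 1) => // n; rewrite -[leRHS](mean_cst 1).
  by apply: mean_le => [||x]; [exact: ramp_Lip|exact: Lip_cst|exact: ramp_le1].
have fL n : Lip (f n) by exact: cover_Lip cf _.
pose phi x := Num.min 1 (m%:R * g x).
have phiL : Lip phi by apply: Lip_min; [exact: Lip_cst|exact: LipZ].
have phi0 x : 0 <= phi x by rewrite le_min ler01 mulr_ge0.
pose p n x := Num.min (f n x) (phi x).
pose r n x := f n x - p n x.
pose q n x := ramp g (m + n) x - ramp g m x.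
have pL n : Lip (p n) by exact: Lip_min.
have rL n : Lip (r n) by exact: LipB.
have qL n : Lip (q n) by apply: LipB; exact: ramp_Lip.
have p0 n x : 0 <= p n x by rewrite le_min (cover_ge0 cf) phi0.
have q0 n x : 0 <= q n x by rewrite subr_ge0 ramp_nd// leq_addr.
have pnd k n x : (k <= n)%N -> p k x <= p n x.
  move=> kn; have := cover_nd x cf kn; rewrite /p.
  by case: (leP (f k x) (phi x)); case: (leP (f n x) (phi x)); lra.
have rnd k n x : (k <= n)%N -> r k x <= r n x.
  move=> kn; have := cover_nd x cf kn; rewrite /r /p.
  by case: (leP (f k x) (phi x)); case: (leP (f n x) (phi x)); lra.
(* both sequences increase, so indices can be raised to a common value *)
have prc k n : L (p k) + L (r n) <= c.
  apply: le_trans (cover_mean cf (maxn k n)).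
  have -> : L (f (maxn k n)) = L (p (maxn k n)) + L (r (maxn k n)).
    by rewrite -(meanD Lm)//; congr L; apply/funext => x; rewrite /r; lra.
  apply: lerD; apply: mean_le => // x; first exact: pnd (leq_maxl _ _).
  exact: rnd (leq_maxr _ _).
pose a := sup (range (fun n => L (p n))).
have ub : has_ubound (range (fun n => L (p n))).
  by exists (c - L (r 0%N)) => _ [n _ <-]; have := prc n 0%N; lra.
have pa n : L (p n) <= a by apply: ub_le_sup => //; exists n.
have ra n : L (r n) <= c - a.
  rewrite lerBrDl -lerBrDr; apply: ge_sup.
    by exists (L (p 0%N)); exists 0%N.
  by move=> _ [k _ <-]; have := prc k n; lra.
have U : (outer (X `&` [set x | (0 < g x)%R]) <= (a + e)%:E)%E.
  apply: (@outer_le _ _ (fun n x => p n x + q n x)); split.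
  - by move=> n; exact: LipD.
  - by move=> n x; rewrite addr_ge0.
  - move=> n x; rewrite lerD ?pnd// lerD2r ramp_nd//.
    by rewrite leq_add2l.
  - move=> x [Xx /= gx]; have [n1 fn1] := cover_ge1 cf Xx.
    have [mg|mg] := leP 1 (m%:R * g x).
      exists n1; rewrite ler_wpDr//.
      by rewrite /p le_min fn1 /phi le_min lexx mg.
    have [n2 gn2] : exists n, 2 <= n%:R * g x.
      exists (Num.truncn (2 / g x)).+1.
      by rewrite -ler_pdivrMr// ltW// truncnS_gt// divr_ge0.
    exists n2; rewrite ler_wpDl//.
    have mg1 : m%:R * g x - 1 <= 0 by rewrite subr_le0 ltW.
    rewrite /q /ramp natrD [Num.max 0 (m%:R * g x - 1)]max_l//.
    rewrite [Num.min _ 0]min_r// subr0.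
    rewrite le_min lexx/= le_max; apply/orP; right.
    by have := mulr_ge0 (ler0n R m) (g0 x); rewrite mulrDl => ?; lra.
  - move=> n; rewrite (meanD Lm)// lerD// meanB; [|exact: ramp_Lip..].
    by rewrite lerBlDl rm.
have V : (outer (X `&` ~` [set x | (0 < g x)%R]) <= (c - a)%:E)%E.
  apply: (@outer_le _ _ r); split => //.
  - by move=> n x; rewrite subr_ge0 /p ge_min lexx.
  - by move=> n x; exact: rnd.
  - move=> x [Xx /= /negP]; rewrite -leNgt => gx.
    have {gx} gx : g x = 0 by apply/eqP; rewrite eq_le gx g0.
    have [n fn] := cover_ge1 cf Xx; exists n.
    rewrite /r /p /phi gx mulr0 [Num.min 1 0]min_r// min_r ?subr0//.
    exact: le_trans fn.
by apply: le_trans (leeD U V) _; rewrite -!EFinD lee_fin; lra.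
Qed.

End mean.

(** * Total mass of the outer measure *)

Section separable.
Context {R : realType} {Y : completeMetricType R}.
Implicit Types (u : nat -> Y).

Lemma separable_dense_seq : separable Y ->
  exists u, forall x (e : R), 0 < e -> exists i, mdist (u i) x < e.
Proof.
case=> S /countable_injP[j /= jinj] Sd.
have /choice[u uP] n : exists y, (exists2 s, S s & j s = n) -> S y /\ j y = n.
  have [[s Ss jsn]|nS] := pselect (exists2 s, S s & j s = n); first by exists s.
  by exists point => /nS.
(* an open set is wanted, hence the interior of the ball *)
exists u => x e e0.
have [//||y [yxe Sy]] := Sd (ball x e)^°.
- by exists x; exact: nbhsx_ballx.
- exact: open_interior.
exists (j y); have [Suj juj] := uP (j y) (ex_intro2 _ _ _ Sy erefl).
rewrite (jinj _ _ _ _ juj) ?inE// metric_sym.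
by have := interior_subset yxe; rewrite ballEmdist.
Qed.

Fixpoint gap u k x : R :=
  if k is k'.+1 then Num.min (gap u k' x) (mdist (u k) x) else mdist (u 0%N) x.

Lemma gap_ge0 u k x : 0 <= gap u k x.
Proof. by elim: k => [|k ih] /=; rewrite ?le_min ?ih mdist_ge0. Qed.

Lemma gap_klip u k : klip 1 (gap u k).
Proof.
by elim: k => [|k ih] /=; [|apply: klip_min => //]; exact: klip_dist.
Qed.

Lemma gap_le u k x : gap u k x <= mdist (u k) x.
Proof. by case: k => [|k] //=; rewrite ge_min lexx orbT. Qed.

(** The sets [C n] decrease, and each [C n] lies within [1/(n+1)] of finitely
many points. An ultrafilter that contains them all must then contain a small
ball of each size; it is therefore Cauchy, and its limit adheres to each
[C n]. *)
Lemma complete_nested_inter u (K : nat -> nat) (C : nat -> set Y) :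
  (forall n, C n !=set0) -> (forall n, C n.+1 `<=` C n) ->
  (forall n y, C n y -> gap u (K n) y <= n.+1%:R^-1) ->
  exists x, forall n, closure (C n) x.
Proof.
move=> C0 CS CK.
have Cle m n : (m <= n)%N -> C n `<=` C m.
  elim: n => [|n ih]; first by rewrite leqn0 => /eqP ->.
  rewrite leq_eqVlt => /predU1P[->//|/ih Cnm].
  exact: subset_trans (CS n) Cnm.
pose F := filter_from [set: nat] C.
have FF : Filter F.
  apply: filter_from_filter; first by exists 0%N.
  move=> i j _ _; exists (maxn i j) => // y Cy; split.
    exact: Cle (leq_maxl _ _) _ Cy.
  exact: Cle (leq_maxr _ _) _ Cy.
have FP : ProperFilter F by apply: filter_from_proper.
have [W [WU FW]] := ultraFilterLemma FP.
have WC n : W (C n) by apply: FW; exists n.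
have [l Wl] : exists l : Y, W --> l.
  suff /cauchy_cvgP Wc : cauchy W by exists (lim W).
  apply: cauchy_exP => e e0.
  have [n ne] := exists_natSinv_lt e0.
  have : W [set y | gap u (K n) y < e].
    by apply: filterS (WC n) => y /CK yK; exact: le_lt_trans yK ne.
  elim: (K n) => [|k ih] Wk /=.
    by exists (u 0%N); apply: filterS Wk => y /=; rewrite ballEmdist.
  have [W1|W2] := in_ultra_setVsetC [set y | gap u k y < e] WU; first exact: ih.
  exists (u k.+1); apply: filterS2 Wk W2 => y /=.
  by rewrite ballEmdist/= gt_min => /orP[->|].
exists l => n B /Wl WB.
exact: filter_ex (filterI (WC n) WB).
Qed.

End separable.

Section total_mass.
Context {R : realType} {Y : completeMetricType R}.
Variables (L : (Y -> R) -> R) (Lm : lip_mean L) (sepY : separable Y).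

(** A quantitative form of tightness: for [L], most of the mass is close to
finitely many points of a dense sequence. *)
Lemma mean_gap_small u (e : R) : 0 < e ->
  (forall x (e : R), 0 < e -> exists i, mdist (u i) x < e) ->
  exists k, L (gap u k) <= e.
Proof.
move=> e0 ud; apply: (mean_cvg0 Lm) => //.
- by move=> n; apply/Lip1P; exact: gap_klip.
- by move=> n x; exact: gap_ge0.
- by move=> n x /=; rewrite ge_min lexx.
- move=> x d d0; have [i /ltW uid] := ud x d d0.
  by exists i; exact: le_trans (gap_le _ _ _) uid.
Qed.

(** Suppose that for no [n] does [f n > 1 - d] hold on all of the closed set
where the gaps [gap u (K m)], [m <= n], are at most [1/(m+1)]. Then
[complete_nested_inter] gives a point at which no [f n] exceeds [1 - d],
although [f n] reaches 1 there. So for some [n], at each point either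
[f n > 1 - d] or some [(m+1) gap u (K m)], [m <= n], exceeds 1: the function
[f n + G + d] is at least 1, and [K] is chosen so that [L G <= d]. *)
Lemma full_cover_ge1 c f : lip_cover L setT c f -> 1 <= c.
Proof.
move=> cf; have [u ud] := separable_dense_seq sepY.
apply/ler_addgt0Pr => e e0; have d0 : 0 < e / 2 by rewrite divr_gt0.
set d := e / 2 in d0.
(* budget for L (gap u (K n)); after multiplication by n + 1 it sums to d *)
pose w n : R := d / 2 ^+ n.+1 / n.+1%:R.
have w0 n : 0 < w n by rewrite !divr_gt0// exprn_gt0.
have /choice[K KP] n := mean_gap_small (w0 n) ud.
have fL n : Lip (f n) by exact: cover_Lip cf _.
have gL n : Lip (gap u (K n)) by apply/Lip1_Lip/Lip1P; exact: gap_klip.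
pose C n := [set y | f n y <= 1 - d /\
  forall m, (m <= n)%N -> gap u (K m) y <= m.+1%:R^-1].
have [n Cn0] : exists n, C n = set0.
  apply: contrapT => /forallNP C0.
  have [|||x xC] := @complete_nested_inter _ _ u K C.
  - by move=> n; apply/set0P/eqP; exact: C0.
  - move=> n y [fy gy]; split; first exact: le_trans (cover_ndS cf _ _) fy.
    by move=> m mn; apply: gy; exact: leqW.
  - by move=> n y [_]; exact.
  have [n fn1] := cover_ge1 cf (I : setT x).
  have xd : nbhs x [set y | 1 - d < f n y].
    have /LipP[k k0 fk] := fL n.
    apply: open_nbhs_nbhs; split; first exact: klip_gt_open fk.
    by rewrite /= (lt_le_trans _ fn1)// ltrBlDr ltrDl.
  have [y [[fy _] /=]] := xC n _ xd.
  by rewrite ltNge fy.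
pose G y := \sum_(m < n.+1) (m.+1%:R * gap u (K m) y).
have mgL m : Lip (fun y => m.+1%:R * gap u (K m) y) by exact: LipZ.
have GL : Lip G.
  exact: (@Lip_sum _ _ n.+1 (fun m y => m.+1%:R * gap u (K m) y)).
have G0 y (m : 'I_n.+1) : 0 <= m.+1%:R * gap u (K m) y.
  by rewrite mulr_ge0// gap_ge0.
have LG : L G <= d.
  rewrite (mean_sum Lm n.+1 mgL).
  apply: (@le_trans _ _ (\sum_(m < n.+1) d / 2 ^+ m.+1)).
    apply: ler_sum => m _; rewrite (meanZ Lm)// [leLHS]mulrC.
    by rewrite -ler_pdivlMr// KP.
  have -> : \sum_(m < n.+1) d / 2 ^+ m.+1 = d - d / 2 ^+ n.+1.
    elim: n.+1 => [|k ih]; first by rewrite big_ord0 expr0; lra.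
    by rewrite big_ord_recr/= ih exprS invfM mulrCA; lra.
  by rewrite gerBl divr_ge0// ?exprn_ge0// ltW.
have f1G y : 1 <= f n y + G y + d.
  rewrite leNgt; apply/negP => fG.
  have Gy0 : 0 <= G y by exact: sumr_ge0.
  have fy0 : 0 <= f n y by exact: cover_ge0 cf _ _.
  have : C n y; last by rewrite Cn0.
  split=> [|m]; first lra.
  rewrite -ltnS => mn; rewrite -[leRHS]mul1r ler_pdivlMr// mulrC.
  apply: (@le_trans _ _ (G y)); last lra.
  by rewrite /G (bigD1 (Ordinal mn))//= lerDl sumr_ge0.
have : L (fun=> 1) <= L (fun y => f n y + G y + d).
  apply: (mean_le Lm) => //; first exact: Lip_cst.
  by apply: LipD; [exact: LipD|exact: Lip_cst].
rewrite (meanD Lm); [|exact: LipD|exact: Lip_cst].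
rewrite (meanD Lm)// !(mean_cst Lm) => /le_trans; apply.
have := cover_mean cf n; rewrite /d in LG *; lra.
Qed.

Lemma outer_setT : outer L setT = 1%E.
Proof.
apply/eqP; rewrite eq_le (outer_le1 Lm)/=.
by apply: outer_ge => c f cf; rewrite lee_fin; exact: full_cover_ge1 cf.
Qed.

HB.instance Definition _ := isOuterMeasure.Build R Y (outer L)
  (outer_set0 Lm) (outer_nonneg Lm) (@outer_mono R Y L) (outer_sigma Lm).

Lemma borel_caratheodory (A : set (borel Y)) :
  measurable A -> (outer L).-caratheodory A.
Proof.
apply: smallest_sub.
  by have := sigma_algebra_measurable (caratheodory_type (outer L)).
move=> U /open_klip[g [g1 g0 ->]]; apply: le_caratheodory_measurable => X.
exact: (outer_caratheodory_gt0 Lm (klip_Lip ler01 g1) g0).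
Qed.

(** The outer measure under a name of its own, whose domain is the Borel
measurable space. *)
Definition mean_measure (A : set (borel Y)) : \bar R := outer L A.

Let mean_measure_sigma_additive : semi_sigma_additive mean_measure.
Proof.
move=> F mF tF mUF.
apply: (caratheodory_measure_sigma_additive (mu := outer L)) => //.
  by move=> i; exact: borel_caratheodory.
exact: borel_caratheodory.
Qed.

HB.instance Definition _ := isMeasure.Build _ _ _ mean_measure
  (outer_set0 Lm) (outer_nonneg Lm) mean_measure_sigma_additive.

HB.instance Definition _ :=
  Measure_isProbability.Build _ _ _ mean_measure outer_setT.

Lemma mean_probability_exists :
  exists P : probability (borel Y) R, forall A, P A = outer L A.
Proof. by exists mean_measure. Qed.

End total_mass.

(** * Integration of Lipschitz functions *)

Section integral.
Context {R : realType} {Y : completeMetricType R}.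
Implicit Types (mu nu : probability (borel Y) R) (f g : Y -> R).

Definition mint mu f : R := \int[mu]_y f y.

(** The integrability clause of [M]. *)
Definition first_moment mu := forall f, Lip f ->
  (\int[mu]_y `|f y|%:E < +oo)%E.

Lemma integral_cstE mu (c : R) :
  (\int[mu]_y cst c%:E y = c%:E)%E.
Proof.
rewrite integral_cst// -[RHS]mule1.
exact: (congr1 (mule c%:E) (probability_setT mu)).
Qed.

(** Monotone convergence for sequences that are eventually constant at each
point, which covers truncations and approximations of indicators. *)
Lemma Lip_cvg_integral mu (u : nat -> Y -> R) f : (forall n, Lip (u n)) ->
  (forall n x, 0 <= u n x) -> (forall x m n, (m <= n)%N -> u m x <= u n x) ->
  (forall x, \forall n \near \oo, u n x = f x) ->
  (\int[mu]_x (u n x)%:E)%E @[n --> \oo] -->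
  (\int[mu]_x (f x)%:E)%E.
Proof.
move=> uL u0 und uf.
have -> : (\int[mu]_x (f x)%:E =
    \int[mu]_x limn (fun n => (u n x)%:E))%E.
  apply: eq_integral => x _; apply/esym/lim_near_cst => //.
  by apply: filterS (uf x) => n ->.
apply: (@cvg_monotone_convergence _ _ _ mu setT measurableT
  (fun n x => (u n x)%:E)).
- by move=> n; exact: Lip_emeasurable.
- by move=> n x _; rewrite lee_fin.
- by move=> x _ m n mn; rewrite lee_fin und.
Unshelve. all: by end_near. Qed.

Lemma integral_trunc_le mu f (t c : R) :
  Lip f -> (forall x, 0 <= f x) -> 0 < t ->
  (forall m, \int[mu]_x (Num.min (f x) (m%:R * t))%:E <= c%:E)%E ->
  (\int[mu]_x (f x)%:E <= c%:E)%E.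
Proof.
move=> fL f0 t0 h.
have cv :
    (\int[mu]_x (Num.min (f x) (n%:R * t))%:E)%E @[n --> \oo] -->
    (\int[mu]_x (f x)%:E)%E.
  apply: (@Lip_cvg_integral mu (fun n x => Num.min (f x) (n%:R * t))).
  - by move=> n; exact: Lip_minc.
  - by move=> n x; rewrite le_min f0 mulr_ge0// ltW.
  - by move=> x m n mn; rewrite le_min2// ler_wpM2r ?ler_nat// ltW.
  - move=> x; exists (Num.truncn (f x / t)).+1 => // n /= tn.
    rewrite min_l// -ler_pdivrMr//; apply: le_trans (ltW (truncnS_gt _)) _.
    by rewrite ler_nat.
rewrite -(cvg_lim _ cv)//; apply: lime_le; last exact: nearW.
by apply/cvg_ex; eexists; exact: cv.
Qed.

Lemma first_moment_integrable mu f : first_moment mu -> Lip f ->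
  mu.-integrable [set: borel Y] (EFin \o f).
Proof.
move=> mom fL; apply/integrableP; split; first exact: Lip_emeasurable.
exact: mom.
Qed.

Lemma mintE mu f : first_moment mu -> Lip f ->
  (mint mu f)%:E = (\int[mu]_x (f x)%:E)%E.
Proof.
move=> mom fL; rewrite /mint /Rintegral fineK//.
by apply: integrable_fin_num => //; exact: first_moment_integrable.
Qed.

(** Continuity is dominated convergence, with [h 0] as the dominating
function. *)
Lemma mint_mean mu : first_moment mu -> lip_mean (mint mu).
Proof.
move=> mom; have int f := @first_moment_integrable mu f mom; split.
- rewrite /mint Rintegral_cst// mul1r.
  exact: (congr1 fine (probability_setT mu)).
- by move=> f g /int fi /int gi; rewrite /mint RintegralD.
- by move=> c f /int fi; rewrite /mint RintegralZl.
- by move=> f fL f0; apply: Rintegral_ge0.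
move=> h h1 h0 hS hcvg e e0.
have hL n := Lip1_Lip (h1 n).
have hnd x m n : (m <= n)%N -> h n x <= h m x.
  by apply: (nonincreasing_seqP (h^~ x)).1 => k; exact: hS.
have [] := @dominated_convergence _ _ _ mu setT measurableT
  (fun n x => (h n x)%:E) (cst 0%E) (fun x => (h 0%N x)%:E).
- by move=> n; exact: Lip_emeasurable.
- exact: measurable_cst.
- apply: nearW => x _; apply: cvg_EFin; first exact: nearW.
  apply/cvgrPdist_le => d d0; have [n hn] := hcvg x d d0.
  exists n => // m /= nm; rewrite sub0r normrN ger0_norm//.
  exact: le_trans (hnd x _ _ nm) hn.
- exact: int.
- by apply: nearW => x n _; rewrite gee0_abs ?lee_fin// hnd.
move=> _ _; rewrite integral0 => /fine_cvgP[_ /cvgrPdist_le/(_ e e0)[n _]].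
move=> /(_ n (leqnn n)); rewrite /= sub0r normrN => hn; exists n.
exact: le_trans (ler_norm _) hn.
Qed.

End integral.

(** * Representation of a functional by a measure *)

Section representation.
Context {R : realType} {Y : completeMetricType R}.
Variables (L : (Y -> R) -> R) (Lm : lip_mean L).
Variables (P : probability (borel Y) R) (PE : forall A, P A = outer L A).
Implicit Types f : Y -> R.

(** The part of [f] between the heights [a] and [a + t], divided by [t], is 1
where [f >= a + t]; as a constant sequence it witnesses the bound. *)
Lemma layer_le f (a t : R) : Lip f -> 0 <= a -> 0 < t ->
  (t%:E * P [set x | (a + t <= f x)%R] <=
   (L (fun x => Num.min (f x) (a + t)) - L (fun x => Num.min (f x) a))%:E)%E.
Proof.
move=> fL a0 t0; rewrite PE muleC -lee_pdivlMr// -EFinM mulrC.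
have mL c : Lip (fun x => Num.min (f x) c) by exact: Lip_minc.
have sL : Lip (fun x => Num.min (f x) (a + t) - Num.min (f x) a) by exact: LipB.
rewrite -(meanB Lm)// -(meanZ Lm)//.
apply: (@outer_le _ _ L _ _ (fun _ x =>
  t^-1 * (Num.min (f x) (a + t) - Num.min (f x) a))).
split => // [n|n x|x /= fx].
- exact: LipZ.
- apply: mulr_ge0; first by rewrite invr_ge0 ltW.
  by rewrite subr_ge0 le_min2// lerDl ltW.
- exists 0%N; rewrite !min_r//.
    by rewrite addrAC subrr add0r mulVf// gt_eqF.
  by apply: le_trans fx; rewrite lerDl ltW.
Qed.

(** By induction on [m]: the layer of [f] above [a + t] lies below [t] times
the indicator of [{f >= a + t}], so by [layer_le] its integral is at most the
value of [L] on the layer just below. This shift by one layer accounts for the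
summand [t]. *)
Lemma integral_min_le f (t : R) m : Lip f -> (forall x, 0 <= f x) -> 0 < t ->
  (\int[P]_x (Num.min (f x) (m.+1%:R * t))%:E <=
   (t + L (fun x => Num.min (f x) (m%:R * t)))%:E)%E.
Proof.
move=> fL f0 t0.
have mL c : Lip (fun x => Num.min (f x) c) by exact: Lip_minc.
have mt0 n : 0 <= n%:R * t by rewrite mulr_ge0// ltW.
have m0 n x : 0 <= Num.min (f x) (n%:R * t) by rewrite le_min f0 mt0.
elim: m => [|m ih].
  rewrite [X in L X](_ : _ = fun=> 0); last first.
    by apply/funext => x; rewrite mul0r min_r.
  rewrite (mean_cst Lm) addr0.
  apply: (@le_trans _ _ (\int[P]_x (cst t%:E x))%E).
    apply: ge0_le_integral => //.
    - by move=> x _; rewrite lee_fin.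
    - exact: Lip_emeasurable.
    - by move=> x _; rewrite lee_fin mul1r ge_min lexx orbT.
  by rewrite integral_cstE.
set a := m%:R * t; have E1 : m.+1%:R * t = a + t by rewrite -natr1 mulrDl mul1r.
have E2 : m.+2%:R * t = a + t + t by rewrite -natr1 mulrDl mul1r E1.
rewrite E1 E2 in ih *.
pose s x := Num.min (f x) (a + t + t) - Num.min (f x) (a + t).
have sL : Lip s by exact: LipB.
have s0 x : 0 <= s x by rewrite subr_ge0 le_min2// lerDl ltW.
have -> : (\int[P]_x (Num.min (f x) (a + t + t))%:E =
    \int[P]_x (Num.min (f x) (a + t))%:E + \int[P]_x (s x)%:E)%E.
  rewrite -ge0_integralD//.
  - by apply: eq_integral => x _; rewrite -EFinD /s subrKC.
  - by move=> x _; rewrite lee_fin -E1.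
  - exact: Lip_emeasurable.
  - by move=> x _; rewrite lee_fin.
  - exact: Lip_emeasurable.
have : (\int[P]_x (s x)%:E <=
    (L (fun x => Num.min (f x) (a + t)) - L (fun x => Num.min (f x) a))%:E)%E.
  apply: le_trans (layer_le fL (mt0 m) t0).
  pose A : set (borel Y) := [set x | a + t <= f x].
  have mA : measurable A.
    have := Lip_measurable fL measurableT (measurable_itv `[a + t, +oo[).
    rewrite setTI; congr measurable; apply/seteqP.
    by split=> x; rewrite /A /= in_itv/= andbT.
  apply: (@le_trans _ _ (\int[P]_x (t * \1_A x)%:E)%E).
    apply: ge0_le_integral => //.
    - by move=> x _; rewrite lee_fin.
    - exact: Lip_emeasurable.
    - by apply/measurable_EFinP/measurable_funM.
    - move=> x _; rewrite lee_fin indicE; have [xA|xA] := boolP (x \in A).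
        move: xA; rewrite inE /A /= mulr1 => h.
        by rewrite /s [X in _ - X]min_r// lerBlDr addrC ge_min lexx orbT.
      move: xA; rewrite notin_setE /A /= => /negP; rewrite -ltNge => h.
      by rewrite /s !min_l ?subrr ?mulr0// ?ltW// (lt_trans h)// ltrDl.
  rewrite (integralZl_indic measurableT (fun=> A))//; last by rewrite ltNge ltW.
  by have := integral_indic P measurableT mA; rewrite setIT => ->.
move=> h; apply: le_trans (leeD ih h) _.
by rewrite -EFinD lee_fin -/a; lra.
Qed.

Lemma integral_le_mean f : Lip f -> (forall x, 0 <= f x) ->
  (\int[P]_x (f x)%:E <= (L f)%:E)%E.
Proof.
move=> fL f0; apply/lee_addgt0Pr => t t0; rewrite -EFinD.
apply: (integral_trunc_le fL f0 t0) => m.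
have mL c : Lip (fun x => Num.min (f x) c) by exact: Lip_minc.
apply: (@le_trans _ _ (\int[P]_x (Num.min (f x) (m.+1%:R * t))%:E)%E).
  apply: ge0_le_integral => //.
  - by move=> x _; rewrite lee_fin le_min f0 mulr_ge0// ltW.
  - exact: Lip_emeasurable.
  - exact: Lip_emeasurable.
  - by move=> x _; rewrite lee_fin le_min2// ler_wpM2r ?ler_nat// ltW.
apply: le_trans (integral_min_le m fL f0 t0) _.
rewrite lee_fin addrC lerD2r; apply: (mean_le Lm) => // x.
by rewrite ge_min lexx.
Qed.

Lemma mean_first_moment : first_moment P.
Proof.
move=> f fL; have nL : Lip (fun x => `|f x|).
  rewrite (_ : (fun x => _) = fun x => Num.max (f x) (- f x)).
    by apply: Lip_max => //; exact: LipN.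
  by apply/funext => x; rewrite maxrN.
apply: le_lt_trans (integral_le_mean nL _) _ => [x|]; first exact: normr_ge0.
exact: ltry.
Qed.

(** As [P] has mass 1 and [L] is normalized, applying [integral_le_mean] to
[c - f] reverses the inequality for [f <= c]. A nonnegative [f] is [min(f, n)]
plus the tail [max(0, f - n)], and the tails, rescaled to be 1-Lipschitz,
decrease to 0. *)
Lemma mintE_mean f : Lip f -> mint P f = L f.
Proof.
have Pm := mean_first_moment; have Im := mint_mean Pm.
have le0 g : Lip g -> (forall x, 0 <= g x) -> mint P g <= L g.
  by move=> gL g0; rewrite -lee_fin (mintE Pm gL) integral_le_mean.
have gebd g (c : R) : Lip g -> (forall x, g x <= c) -> L g <= mint P g.
  move=> gL gc; have := le0 (fun x => c - g x).
  rewrite (meanB Im)//; last exact: Lip_cst.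
  rewrite (meanB Lm)//; last exact: Lip_cst.
  rewrite !mean_cst// lerD2l lerN2; apply=> [|x]; last by rewrite subr_ge0.
  by apply: LipB => //; exact: Lip_cst.
have eq0 g : Lip g -> (forall x, 0 <= g x) -> mint P g = L g.
  move=> gL g0; apply/eqP; rewrite eq_le le0//=; apply/ler_addgt0Pr => e e0.
  have /LipP[k k0 gk] := gL.
  have k1 : 0 < k + 1 by lra.
  pose h n x := (k + 1)^-1 * Num.max 0 (g x - n%:R).
  have hL n : Lip (fun x => Num.max 0 (g x - n%:R)).
    by apply: Lip_max; [exact: Lip_cst|apply: LipB => //; exact: Lip_cst].
  have [|||||n Ln] := mean_cvg0 Lm (h := h) _ _ _ _ (e := e / (k + 1)).
  - move=> n; apply/Lip1P/klip_rescale => //.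
    apply: klip_max; first exact: klip_cst.
    by move=> x y; rewrite addrAC lerD2r; exact: gk.
  - by move=> n x; rewrite mulr_ge0 ?invr_ge0 ?le_max ?lexx// ltW.
  - move=> n x; apply: ler_wpM2l; first by rewrite invr_ge0 ltW.
    by apply: le_max2 => //; rewrite lerB// ler_nat.
  - move=> x d d0; exists (Num.truncn (g x)).+1.
    by rewrite /h max_l ?mulr0; [exact: ltW|rewrite subr_le0 ltW// truncnS_gt].
  - by rewrite divr_gt0.
  move: Ln; rewrite (meanZ Lm)// mulrC ler_pM2r ?invr_gt0// => Ln.
  have -> : L g =
      L (fun x => Num.min (g x) n%:R) + L (fun x => Num.max 0 (g x - n%:R)).
    rewrite -(meanD Lm)//; last exact: Lip_minc.
    congr L; apply/funext => x.
    by case: (leP (g x) n%:R); case: (leP 0 (g x - n%:R)); lra.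
  apply: lerD => //.
  apply: (@le_trans _ _ (mint P (fun x => Num.min (g x) n%:R))).
    apply: (gebd _ n%:R) => [|x]; first exact: Lip_minc.
    by rewrite ge_min lexx orbT.
  by apply: (mean_le Im) => // [|x]; [exact: Lip_minc|rewrite ge_min lexx].
move=> fL.
have pL : Lip (fun x => Num.max 0 (f x)).
  by apply: Lip_max => //; exact: Lip_cst.
have nL : Lip (fun x => Num.max 0 (- f x)).
  by apply: Lip_max; [exact: Lip_cst|exact: LipN].
have -> : f = (fun x => Num.max 0 (f x) - Num.max 0 (- f x)).
  by apply/funext => x; case: (leP 0 (f x)); case: (leP 0 (- f x)); lra.
by rewrite (meanB Im)// (meanB Lm)// !eq0// => x; rewrite le_max lexx.
Qed.

End representation.

(** * Separation, and measures with bounded support *)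

Section uniqueness.
Context {R : realType} {Y : completeMetricType R}.
Implicit Types (mu nu : probability (borel Y) R) (f g : Y -> R).

Lemma borel_probability_inj mu nu : borel_probability mu ->
  borel_probability nu -> (forall A, measurable A -> mu A = nu A) -> mu = nu.
Proof.
move=> bmu bnu e; have [P [_ PU]] := borel_probability_exists_unique nu.
by rewrite -(PU mu)// -(PU nu).
Qed.

Lemma mint_Lip1_Lip mu nu : first_moment mu -> first_moment nu ->
  (forall f, Lip1 f -> mint mu f = mint nu f) ->
  forall f, Lip f -> mint mu f = mint nu f.
Proof.
move=> mmu mnu e f fL; have /LipP[k k0 fk] := fL.
have k1 : 0 < k + 1 by lra.
have : mint mu (fun x => (k + 1)^-1 * f x) =
       mint nu (fun x => (k + 1)^-1 * f x).
  by apply: e; apply/Lip1P; exact: klip_rescale.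
rewrite (meanZ (mint_mean mmu))// (meanZ (mint_mean mnu))//.
by apply: mulfI; rewrite gt_eqF// invr_gt0.
Qed.

(** The open sets form a generating pi-system, and the measure of [{g > 0}] is
the limit of the integrals of [min(1, n g)]. *)
Lemma mint_separates mu nu : first_moment mu -> first_moment nu ->
  (forall f, Lip1 f -> mint mu f = mint nu f) ->
  forall A, measurable A -> mu A = nu A.
Proof.
move=> mmu mnu /(mint_Lip1_Lip mmu mnu) e A mA.
apply: (@measure_unique _ R (borel Y) (@open Y) (fun=> setT)
  _ _ _ _ mu nu) => //.
- by move=> B C; exact: openI.
- by move=> _; exact: openT.
- by rewrite bigcup_const//; exists 0%N.
- move=> U oU; have mU := open_borel oU.
  have [g [g1 g0 UE]] := open_klip oU.
  have gL := klip_Lip ler01 g1.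
  have cv (P : probability (borel Y) R) :
      (\int[P]_x (Num.min 1 (n%:R * g x))%:E)%E @[n --> \oo] --> P U.
    have <- : (\int[P]_x (\1_U x)%:E = P U)%E.
      by rewrite integral_indic// setIT.
    apply: (@Lip_cvg_integral _ _ P (fun n x => Num.min 1 (n%:R * g x))).
    + by move=> n; apply: Lip_min; [exact: Lip_cst|exact: LipZ].
    + by move=> n x; rewrite le_min ler01 mulr_ge0.
    + by move=> x m n mn; rewrite le_min2// ler_wpM2r ?ler_nat.
    + move=> x; rewrite indicE; have [xU|xU] := boolP (x \in U); last first.
        apply: nearW => n; move: xU; rewrite notin_setE UE /= => /negP.
        rewrite -leNgt => gx0.
        have -> : g x = 0 by apply/eqP; rewrite eq_le gx0 g0.
        by rewrite mulr0 min_r.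
      move: xU; rewrite inE UE /= => gx0.
      exists (Num.truncn (g x)^-1).+1 => // n /= tn.
      rewrite min_l// -ler_pdivrMr// div1r.
      apply: le_trans (ltW (truncnS_gt _)) _.
      by rewrite ler_nat.
  apply: cvg_unique (cv mu) _; first exact: ereal_hausdorff.
  have -> : (fun n => \int[mu]_x (Num.min 1 (n%:R * g x))%:E)%E =
     (fun n => \int[nu]_x (Num.min 1 (n%:R * g x))%:E)%E.
    apply/funext => n.
    have hL : Lip (fun x => Num.min 1 (n%:R * g x)).
      by apply: Lip_min; [exact: Lip_cst|exact: LipZ].
    by rewrite -!mintE// e.
  exact: cv.
- move=> _; exact: (le_lt_trans (probability_le1 mu measurableT) (ltry _)).
Qed.

End uniqueness.

Section bounded_support.
Context {R : realType} {Y : completeMetricType R}.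
Implicit Types (mu : probability (borel Y) R).

Lemma supp_open mu : open (~` supp mu).
Proof. by rewrite /supp setCK; apply: bigcup_open => A []. Qed.

(** The complement of the support is a union of open null sets, possibly
uncountable. Each of its points lies in one of countably many null balls, with
centres in a dense sequence and radii [1/(n+1)]. *)
Lemma supp_null mu : separable Y -> mu (~` supp mu) = 0%E.
Proof.
move=> /separable_dense_seq[u ud].
have mN : measurable (~` supp mu : set (borel Y)).
  by apply: open_borel; exact: supp_open.
apply/(negligibleP _ mN).
(* the ball of radius 1/(n+1) around u i, as a set on which a Lipschitz function
   exceeds a constant *)
pose D i n : set (borel Y) := [set y | - (n.+1%:R^-1) < - mdist (u i) y].
have oD i n : open (D i n).
  apply: (@klip_gt_open _ _ 1 (fun y => - mdist (u i) y)) => //.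
  by apply: klipN; exact: klip_dist.
pose B i n := if pselect (mu (D i n) = 0%E) then D i n else set0.
apply: (@negligibleS _ _ _ mu (\bigcup_i \bigcup_n B i n)).
  rewrite /supp setCK => x [A [oA A0] Ax].
  have /nbhs_ballP[e /= e0 xeA] : nbhs (x : Y) A by apply: open_nbhs_nbhs.
  have [n ne] : exists n, n.+1%:R^-1 < e / 2.
    by apply: exists_natSinv_lt; rewrite divr_gt0.
  have [i ui] := ud x n.+1%:R^-1 (ltac:(by rewrite invr_gt0)).
  exists i => //; exists n => //; rewrite /B; case: pselect => [h|Dn0] /=.
    by rewrite /D /= ltrN2.
  exfalso; apply: Dn0; apply/eqP; rewrite eq_le measure_ge0 andbT -A0.
  apply: le_measure; rewrite ?inE; [|exact: open_borel|].
    exact: open_borel (oD i n).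
  move=> y; rewrite /D /= ltrN2 => uy; apply: xeA; rewrite ballEmdist/=.
  rewrite (le_lt_trans (metric_triangle x (u i) y))// [mdist x (u i)]metric_sym.
  by apply: lt_trans (ltrD ui uy) _; rewrite [ltRHS]splitr ltrD.
apply: negligible_bigcup => i; apply: negligible_bigcup => n; rewrite /B.
case: pselect => [h|h] /=; last exact: negligible_set0.
by apply/negligibleP => //; exact: open_borel (oD i n).
Qed.

(** A Lipschitz function is bounded on the support, which carries all the
mass. *)
Lemma Mloc_sub_M : separable Y -> Mloc Y `<=` M Y.
Proof.
move=> sepY mu [bmu [m sm]]; split => // f fL.
have /LipP[k k0 /klip_normP fk] := fL.
have [C fC] : exists C, forall y, supp mu y -> `|f y| <= C.
  have [[x sx]|s0] := pselect (supp mu !=set0); last first.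
    by exists 0 => y sy; exfalso; apply: s0; exists y.
  exists (`|f x| + k * m) => y sy.
  have := fk y x; have := ler_normD (f x) (f y - f x).
  have := ler_wpM2l k0 (sm y x sy sx); rewrite subrKC; lra.
have oN := supp_open mu; have N0 := supp_null mu sepY.
have mN := open_borel oN.
have mf : measurable_fun [set: borel Y] (fun y => `|f y|%:E).
  apply/measurable_EFinP; apply: measurableT_comp => //.
  exact: Lip_measurable.
rewrite (ge0_negligible_integral mN)//.
have mD : measurable ([set: borel Y] `\` ~` supp mu) by exact: measurableD.
apply: (@le_lt_trans _ _
  (\int[mu]_(y in [set: borel Y] `\` ~` supp mu) cst C%:E y)%E).
  apply: ge0_le_integral => //.
  - exact: measurable_funS mf.
  - by move=> y [_ /= /contrapT sy]; rewrite lee_fin fC.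
by rewrite integral_cst// ltey_eq fin_numM//; exact: fin_num_measure.
Qed.

End bounded_support.

(** * The Kantorovich metric and its completeness *)

Section kantorovich.
Context {R : realType} {Y : completeMetricType R}.
Implicit Types (mu nu : M Y) (f g : Y -> R).

Lemma M_borel mu : borel_probability (val mu).
Proof. by have [] := set_mem (valP mu). Qed.

Lemma M_first_moment mu : first_moment (val mu).
Proof. by have [] := set_mem (valP mu). Qed.

Lemma kantorovichE mu nu : kantorovich (val mu) (val nu) =
  ereal_sup [set `|mint (val mu) f - mint (val nu) f|%:E | f in @Lip1 R Y].
Proof.
congr ereal_sup; apply: eq_imagel => f /Lip1_Lip fL.
by rewrite -!mintE//; exact: M_first_moment.
Qed.

(** Both integrals are within the mean distance to the base point of the value
of [f] at that point. *)
Lemma mint_sub_le mu nu f : Lip1 f -> `|mint (val mu) f - mint (val nu) f| <=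
  mint (val mu) (mdist point) + mint (val nu) (mdist point).
Proof.
move=> f1; have fL := Lip1_Lip f1; have dL := @Lip_dist R Y point.
have bd (la : M Y) :
    `|mint (val la) f - f point| <= mint (val la) (mdist point).
  have Lm := mint_mean (@M_first_moment la).
  have f1' := (Lip1P f).1 f1.
  have : mint (val la) (fun x => f x - f point) <= mint (val la) (mdist point).
    apply: (mean_le Lm) => // [|x]; first by apply: LipB => //; exact: Lip_cst.
    by have := f1' x point; rewrite mul1r metric_sym; lra.
  have : mint (val la) (fun x => f point - f x) <= mint (val la) (mdist point).
    apply: (mean_le Lm) => // [|x]; first by apply: LipB => //; exact: Lip_cst.
    by have := f1' point x; rewrite mul1r; lra.
  rewrite !(meanB Lm)//; [|exact: Lip_cst..].
  by rewrite (mean_cst Lm) ler_norml; lra.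
have := bd mu; have := bd nu; rewrite !ler_norml; lra.
Qed.

Lemma kantorovich_fin mu nu : kantorovich (val mu) (val nu) \is a fin_num.
Proof.
rewrite kantorovichE ge0_fin_numE.
  apply: (@le_lt_trans _ _ (mint (val mu) (mdist point) +
    mint (val nu) (mdist point))%:E); last exact: ltry.
  by apply: ge_ereal_sup => _ [f f1 <-]; rewrite lee_fin mint_sub_le.
apply: ereal_sup_ge.
exists `|mint (val mu) (fun=> 0) - mint (val nu) (fun=> 0)|%:E.
  by exists (fun=> 0) => //; apply/Lip1P; exact: klip_cst.
by rewrite lee_fin.
Qed.

Lemma kantorovich_dist_ge mu nu f : Lip1 f ->
  `|mint (val mu) f - mint (val nu) f| <= kantorovich_dist Y mu nu.
Proof.
move=> f1; rewrite -lee_fin /kantorovich_dist fineK ?kantorovich_fin//.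
by rewrite kantorovichE; apply: ereal_sup_ubound; exists f.
Qed.

Lemma kantorovich_dist_le mu nu (c : R) :
  (forall f, Lip1 f -> `|mint (val mu) f - mint (val nu) f| <= c) ->
  kantorovich_dist Y mu nu <= c.
Proof.
move=> h; rewrite -lee_fin /kantorovich_dist fineK ?kantorovich_fin//.
by rewrite kantorovichE; apply: ge_ereal_sup => _ [f f1 <-]; rewrite lee_fin h.
Qed.

Lemma kantorovich_is_metric : is_metric (kantorovich_dist Y).
Proof.
have cst0 : Lip1 (fun _ : Y => 0 : R) by apply/Lip1P; exact: klip_cst.
split.
- move=> mu; apply/eqP; rewrite eq_le.
  rewrite (le_trans _ (kantorovich_dist_ge mu mu cst0))// andbT.
  by apply: kantorovich_dist_le => f _; rewrite subrr normr0.
- move=> mu nu d0; apply: val_inj.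
  apply: borel_probability_inj; [exact: M_borel..|].
  apply: mint_separates; [exact: M_first_moment..|] => f f1.
  apply/eqP; rewrite -subr_eq0 -normr_le0 -d0.
  exact: kantorovich_dist_ge.
- move=> mu nu; apply/eqP; rewrite eq_le; apply/andP.
  split; apply: kantorovich_dist_le => f f1; rewrite distrC;
    exact: kantorovich_dist_ge.
- move=> nu mu la; apply: kantorovich_dist_le => f f1.
  apply: le_trans (lerD (kantorovich_dist_ge mu nu f1)
                        (kantorovich_dist_ge nu la f1)).
  exact: ler_distD.
Qed.

Lemma M_representation (L : (Y -> R) -> R) : separable Y -> lip_mean L ->
  exists mu, forall f, Lip f -> mint (val mu) f = L f.
Proof.
move=> sepY Lm; have [P PE] := mean_probability_exists Lm sepY.
have [Q [[bQ QP] _]] := borel_probability_exists_unique P.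
have intQ (f : Y -> \bar R) :
    (\int[Q]_y f y = \int[P]_y f y)%E.
  by apply: eq_measure_integral => A mA _; exact: QP.
have MQ : M Y Q.
  by split => // f fL; rewrite /= intQ; exact: mean_first_moment PE _ fL.
exists (exist _ Q (mem_set MQ)) => f fL.
by rewrite -(mintE_mean Lm PE fL) /mint /Rintegral /= intQ.
Qed.

Section cauchy_filter.
Variables (HM : is_metric (kantorovich_dist Y)) (F : set_system (metrized HM)).
Hypotheses (FF : ProperFilter F) (Fc : cauchy F).

Lemma cauchy_near e : 0 < e -> exists nu : M Y,
  F [set mu : metrized HM | kantorovich_dist Y nu mu < e].
Proof.
move=> e0; have /cauchyP/(_ e e0)[nu Fnu] := Fc.
by exists nu; apply: filterS Fnu => mu; rewrite ballEmdist.
Qed.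

Definition lim_mint f : R := lim (mint (val (mu : M Y)) f @[mu --> F]).

Lemma cvg_mint f : Lip f -> mint (val (mu : M Y)) f @[mu --> F] --> lim_mint f.
Proof.
move=> fL; have /LipP[k k0 fk] := fL; have k1 : 0 < k + 1 by lra.
suff /cauchy_cvgP : cauchy (mint (val (mu : M Y)) f @[mu --> F]) by [].
apply: cauchy_exP => e e0.
have ek0 : 0 < e / (k + 1) by rewrite divr_gt0.
have [nu Fnu] := cauchy_near ek0.
exists (mint (val nu) f).
suff : F [set mu | ball (mint (val nu) f) e (mint (val (mu : M Y)) f)] by [].
apply: filterS Fnu => mu /=.
have g1 : Lip1 (fun x => (k + 1)^-1 * f x).
  by apply/Lip1P; exact: klip_rescale.
move=> /(le_lt_trans (kantorovich_dist_ge nu (mu : M Y) g1)).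
rewrite (meanZ (mint_mean (@M_first_moment nu)))//.
rewrite (meanZ (mint_mean (@M_first_moment (mu : M Y))))//.
by rewrite -mulrBr normrM gtr0_norm ?invr_gt0// mulrC ltr_pM2r ?invr_gt0.
Qed.

(** Two measures that are close in the metric are close at all 1-Lipschitz
functions simultaneously, so a single [nu] serves for every [f]. *)
Lemma lim_mint_unif e : 0 < e -> exists2 nu : M Y,
  F [set mu : metrized HM | kantorovich_dist Y nu mu < e] &
  forall f, Lip1 f -> `|lim_mint f - mint (val nu) f| <= e.
Proof.
move=> e0; have [nu Fnu] := cauchy_near e0; exists nu => // f f1.
apply/ler_addgt0Pr => d d0.
have /cvgrPdist_lt/(_ d d0) Fd := cvg_mint (Lip1_Lip f1).
have [mu [/= numu Ld]] := filter_ex (filterI Fnu Fd).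
have := le_lt_trans (kantorovich_dist_ge nu (mu : M Y) f1) numu.
by rewrite ltr_norml; move: Ld; rewrite ltr_norml ler_norml; lra.
Qed.

(** Algebraic properties pass to the limit; continuity is that of the integral
against one measure [nu] that is uniformly close to the limit. *)
Lemma lim_mint_mean : lip_mean lim_mint.
Proof.
have mm (mu : metrized HM) := mint_mean (@M_first_moment (mu : M Y)).
have cu f l :
    Lip f -> mint (val (mu : M Y)) f @[mu --> F] --> l -> lim_mint f = l.
  by move=> fL fl; apply: cvg_unique (cvg_mint fL) fl.
split.
- apply: cu; first exact: Lip_cst.
  under eq_fun do rewrite (mean1 (mm _)); exact: cvg_cst.
- move=> f g fL gL; apply: cu; first exact: LipD.
  under eq_fun do rewrite (meanD (mm _))//.
  by apply: cvgD; exact: cvg_mint.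
- move=> c f fL; apply: cu; first exact: LipZ.
  under eq_fun do rewrite (meanZ (mm _))//.
  by apply: cvgM; [exact: cvg_cst|exact: cvg_mint].
- move=> f fL f0; apply: limr_ge.
    by apply/cvg_ex; eexists; exact: cvg_mint.
  by apply: nearW => mu; exact: (mean_ge0 (mm mu)).
- move=> h h1 h0 hS hc e e0.
  have e20 : 0 < e / 2 by rewrite divr_gt0.
  have [nu _ nuh] := lim_mint_unif e20.
  have [n hn] := mean_cvg0 (mm nu) h1 h0 hS hc e20.
  by exists n; have := nuh _ (h1 n); rewrite ler_norml; lra.
Qed.

Lemma cauchy_filter_cvg : separable Y -> exists l : metrized HM, F --> l.
Proof.
move=> sepY; have [la laE] := M_representation sepY lim_mint_mean.
exists la; apply/fcvg_ballP => e e0.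
have e20 : 0 < e / 2 by rewrite divr_gt0.
have [nu Fnu nuh] := lim_mint_unif e20.
apply: filterS Fnu => mu /= numu; rewrite ballEmdist /=.
have : kantorovich_dist Y la nu <= e / 2.
  by apply: kantorovich_dist_le => f f1; rewrite laE ?nuh//; exact: Lip1_Lip.
have := is_metric_triangle HM nu la mu.
rewrite /mdist /=; lra.
Qed.

End cauchy_filter.

End kantorovich.

(** * Density of the measures with bounded support *)

Section density.
Context {R : realType} {Y : completeMetricType R}.
Implicit Types (mu nu : M Y) (f g : Y -> R).

Definition retract (r : R) (y : borel Y) : borel Y :=
  if mdist point (y : Y) <= r then y else point.

Lemma retract_measurable r : measurable_fun [set: borel Y] (retract r).
Proof.
apply: measurable_fun_ifT => //.
- by apply: measurable_fun_ler => //; exact: Lip_measurable (Lip_dist _).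
Qed.

Lemma retract_dist r y : 0 <= r -> mdist point (retract r y : Y) <= r.
Proof. by move=> r0; rewrite /retract; case: ifPn => // _; rewrite mdistxx. Qed.

(** The radius is [2 n] and not [n], so that a point at distance [t > 2 n],
which is moved by [t], is moved by at most [2 (t - n)]. *)
Lemma Mloc_approx mu (e : R) : separable Y -> 0 < e ->
  exists2 nu, Mloc Y (val nu) & kantorovich_dist Y mu nu <= e.
Proof.
move=> sepY e0; have mom := @M_first_moment _ _ mu; have Im := mint_mean mom.
pose h n (x : Y) := Num.max 0 (mdist point x - n%:R).
have h1 n : klip 1 (h n).
  apply: klip_max; first exact: klip_cst.
  by move=> x y; rewrite addrAC lerD2r; exact: klip_dist.
have hL n := klip_Lip ler01 (h1 n).
have [|||||n hn] := mean_cvg0 Im (h := h) _ _ _ _ (e := e / 2).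
- by move=> n; apply/Lip1P.
- by move=> n x; rewrite le_max lexx.
- by move=> n x; apply: le_max2 => //; rewrite lerB// ler_nat.
- move=> x d d0; exists (Num.truncn (mdist point x)).+1.
  by rewrite /h max_l; [exact: ltW|rewrite subr_le0 ltW// truncnS_gt].
- by rewrite divr_gt0.
pose r : R := n%:R + n%:R; have r0 : 0 <= r by rewrite addr_ge0.
have mT := retract_measurable r.
pose T : {mfun borel Y >-> borel Y} := mfun_Sub (mem_set mT).
pose P : probability (borel Y) R := distribution (val mu) T.
have [Q [[bQ QP] _]] := borel_probability_exists_unique P.
have intQ (f : Y -> \bar R) :
    (\int[Q]_y f y = \int[P]_y f y)%E.
  by apply: eq_measure_integral => A mA _; exact: QP.
have sQ y : supp Q y -> mdist point y <= r.
  move=> sy; rewrite leNgt; apply/negP => ry; apply: sy.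
  exists [set z | r < mdist point z] => //; split.
    by apply: (@klip_gt_open _ _ 1) => //; exact: klip_dist.
  rewrite QP; last first.
    by apply: open_borel; apply: (@klip_gt_open _ _ 1) => //; exact: klip_dist.
  have T0 : T @^-1` [set z : Y | r < mdist point z] = set0.
    by apply/seteqP; split => // z /=; rewrite ltNge (retract_dist _ r0).
  exact: (etrans (congr1 (val mu) T0) (measure0 (val mu))).
have lQ : Mloc Y Q.
  split => //; exists (r + r) => x y /sQ xr /sQ yr.
  apply: le_trans (metric_triangle x point y) _.
  by rewrite [mdist x _]metric_sym lerD.
exists (exist _ Q (mem_set (Mloc_sub_M sepY lQ))) => //.
apply: kantorovich_dist_le => f f1; have fL := Lip1_Lip f1.
have mfT : measurable_fun [set: borel Y] (f \o T).
  by apply: measurableT_comp => //; exact: Lip_measurable.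
pose g y := 2 * h n y; have gL : Lip g by exact: LipZ.
have dle y : `|f y - (f \o T) y| <= g y.
  apply: le_trans (f1 _ _) _; rewrite /g /h /T /= /retract; case: ifPn => [_|].
    by rewrite mdistxx mulr_ge0// le_max lexx.
  rewrite -ltNge /r metric_sym => ry.
  by rewrite max_r; have := ler0n R n; lra.
have ig := first_moment_integrable mom gL.
have iff := first_moment_integrable mom fL.
have id : (val mu).-integrable [set: borel Y]
    (EFin \o (fun y => f y - (f \o T) y)).
  apply: le_integrable ig => //.
    apply/measurable_EFinP; apply: measurable_funB => //.
    exact: Lip_measurable.
  by move=> y _; rewrite /= lee_fin (le_trans (dle y))// ler_norm.
have ifT : (val mu).-integrable [set: borel Y] (EFin \o (f \o T)).
  have := integrableB measurableT iff id; apply: eq_integrable => // y _.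
  by rewrite /= -EFinB opprB addrC subrK.
have -> : mint Q f = \int[val mu]_y (f \o T) y.
  rewrite /mint /Rintegral intQ; congr fine.
  rewrite /P /distribution (integral_pushforward mT)//.
  exact: Lip_emeasurable.
rewrite /mint -RintegralB//.
apply: le_trans (le_normr_Rintegral _ id) _ => //.
apply: (@le_trans _ _ (mint (val mu) g)).
  apply: le_Rintegral => //; exact: (integrable_norm id).
by rewrite (meanZ Im)//; lra.
Qed.

End density.

Theorem theorem2p8 (R : realType) (Y : completeMetricType R) :
  separable Y ->
  [/\ Mloc Y `<=` M Y,
      (forall mu nu : M Y, kantorovich (val mu) (val nu) \is a fin_num)
    & exists HM : is_metric (kantorovich_dist Y),
        complete_space (metrized HM) /\
        dense ([set mu : M Y | Mloc Y (val mu)] : set (metrized HM))].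
Proof.
move=> sepY; split; [exact: Mloc_sub_M|exact: kantorovich_fin|].
exists (kantorovich_is_metric (Y := Y)); split.
  by move=> F FF Fc; exact: cauchy_filter_cvg.
move=> O [mu Omu] oO.
have /nbhs_ballP[e /= e0 muO] : nbhs mu O by apply: open_nbhs_nbhs.
have e20 : 0 < e / 2 by rewrite divr_gt0.
have [nu lnu munu] := Mloc_approx (mu : M Y) sepY e20.
exists nu; split => //; apply: muO; rewrite ballEmdist /=.
by apply: le_lt_trans munu _; rewrite ltr_pdivrMr// mulr2n mulrDr mulr1 ltrDl.
Qed.
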